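(* (a) For the Hamming graph $H(q,n)$ we have $c_2(H(q,n)) = \sqrt{n}$. (b) For the Johnson graph $J(v,n)$ we have $c_2(J(v,n)) = \sqrt{n}$. (c) For a strongly regular graph $G$ of diameter $2$ with parameters $(\nu,k,\lambda,\mu)$ we have \[ c_2(G) = \sqrt{\frac{4(\nu-k-1)(k-r)}{k(\nu-k+r)}}, \qquad \text{where } r = \tfrac12\big(\lambda-\mu+\sqrt{\nu}\big). \]
   Context: Graphs are finite and undirected, with edges being two-element subsets of the vertex set. For a connected graph with vertex set $V$, $d(x,y)$ denotes the length of a shortest path between $x$ and $y$, and the diameter is $\max_{x,y\in V} d(x,y)$; $(V,d)$ is a finite metric space. Distortion: for a finite metric space $(X,d)$ with $N$ elements, an embedding $\varrho : X \to \mathbb{R}^N$ (Euclidean norm $\|\cdot\|$) has distortion $D$ if $d(x,y) \le \|\varrho(x)-\varrho(y)\| \le D\, d(x,y)$ for all $x,y\in X$. The least distortion $c_2(X,d)$ is the least $D$ for which such an embedding exists. For a connected graph $G$ with shortest path metric $d$, $c_2(G) := c_2(V,d)$. Hamming graph $H(q,n)$: for a finite set $X$ of cardinality $q \ge 2$, the vertex set is $X^n$, the set of all vectors of length $n$, and two vertices are adjacent if they differ in exactly one coordinate. Johnson graph $J(v,n)$: for a set $V$ of size $v$ and an integer $n$ with $v \ge 2n$, the vertex set is the set of all $n$-element subsets of $V$, and two vertices $x,y$ are adjacent if $|x\cap y| = n-1$. Strongly regular graph with parameters $(\nu,k,\lambda,\mu)$: a graph with $\nu$ vertices in which every vertex is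 adjacent to $k$ vertices, every pair of adjacent vertices has precisely $\lambda$ common neighbors, and every pair of (distinct) nonadjacent vertices has precisely $\mu$ common neighbors.
   Formalization: In (c), r is taken as ½(λ−μ+√((λ−μ)²+4(k−μ))), with the discriminant in place of ν under the root; as printed, (c) fails, e.g. for J(5,2) with parameters (10,6,3,4), where c₂²=2 but the printed formula gives about 1.936. *)

(* Defs.v *)
From mathcomp Require Import all_boot all_order all_algebra.
From mathcomp Require Import reals.

Set Implicit Arguments.
Unset Strict Implicit.
Unset Printing Implicit Defensive.

Import Order.TTheory GRing.Theory Num.Theory.

Local Open Scope ring_scope.

(* mathcomp-analysis norms 'rV[R]_n by the maximum norm, so the Euclidean norm
   is spelled out. *)
Definition enorm (R : realType) (n : nat) (u : 'rV[R]_n) : R :=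
  Num.sqrt (\sum_i u 0 i ^+ 2).

Definition has_distortion (R : realType) (X : finType) (d : X -> X -> R)
    (rho : X -> 'rV[R]_#|X|) (D : R) : Prop :=
  forall x y : X,
    d x y <= enorm (rho x - rho y) /\ enorm (rho x - rho y) <= D * d x y.

(* [is_c2 d D] says c_2(X, d) = D: the least D is attained.  Requiring
   distortions to be nonnegative only matters when X has at most one point:
   there the inequalities hold for every D, and the convention gives c_2 = 0. *)
Definition is_c2 (R : realType) (X : finType) (d : X -> X -> R) (D : R) : Prop :=
  [/\ 0 <= D,
      exists rho : X -> 'rV[R]_#|X|, has_distortion d rho D
    & forall (D' : R) (rho : X -> 'rV[R]_#|X|),
        0 <= D' -> has_distortion d rho D' -> D <= D'].

Definition simple_graph (V : finType) (e : rel V) : Prop :=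
  symmetric e /\ irreflexive e.

Definition connected_graph (V : finType) (e : rel V) : Prop :=
  forall x y : V, connect e x y.

Definition has_walk (V : finType) (e : rel V) (x y : V) (n : nat) : bool :=
  [exists p : n.-tuple V, path e x p && (last x p == y)].

(* The least length below #|V| of a walk from x to y. A shortest path has fewer
   than #|V| edges, so the value is #|V| exactly when x and y are not
   connected. *)
Definition gdist (V : finType) (e : rel V) (x y : V) : nat :=
  find (has_walk e x y) (iota 0 #|V|).

Lemma gdistP (V : finType) (e : rel V) (x y : V) :
  connect e x y ->
  (exists p : seq V, [/\ path e x p, last x p = y & size p = gdist e x y]) /\
  (forall p : seq V, path e x p -> last x p = y -> (gdist e x y <= size p)%N).
Proof.
have walkP p : path e x p -> last x p = y -> has_walk e x y (size p).
  move=> ep lp; apply/existsP; exists (in_tuple p).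
  by rewrite /= ep lp eqxx.
case/connectP=> p0 ep0; case/shortenP: ep0 => p ep up _ yE.
have ltp : (size p < #|V|)%N.
  by rewrite -[(size p).+1]/(size (x :: p)) -(card_uniqP up) max_card.
have hasw : has (has_walk e x y) (iota 0 #|V|).
  by apply/hasP; exists (size p); [rewrite mem_iota | exact: walkP].
have ltd : (gdist e x y < #|V|)%N.
  by move: hasw; rewrite has_find size_iota.
split.
  have := nth_find 0%N hasw; rewrite nth_iota // add0n.
  by case/existsP => q /andP[eq /eqP lq]; exists q; rewrite size_tuple.
move=> q eq lq; rewrite leqNgt; apply/negP => ltq.
have := before_find 0%N ltq.
by rewrite nth_iota ?add0n ?(ltn_trans ltq ltd) // walkP.
Qed.

Definition diameter (V : finType) (e : rel V) : nat :=
  (\max_(x : V) \max_(y : V) gdist e x y)%N.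

Definition is_graph_c2 (R : realType) (V : finType) (e : rel V) (D : R) : Prop :=
  is_c2 (fun x y : V => (gdist e x y)%:R) D.

Definition hamming (X : finType) (n : nat) : rel (n.-tuple X) :=
  fun x y => #|[set i : 'I_n | tnth x i != tnth y i]| == 1%N.
Arguments hamming : clear implicits.

Definition nsubset (V : finType) (n : nat) : finType := {A : {set V} | #|A| == n}.

(* Written with a successor so that for n = 0 the only vertex is not adjacent to
   itself. *)
Definition johnson (V : finType) (n : nat) : rel (nsubset V n) :=
  fun x y => #|val x :&: val y|.+1 == n.
Arguments johnson : clear implicits.

Definition strongly_regular (V : finType) (e : rel V) (nu k la mu : nat) : Prop :=
  [/\ #|V| = nu,
      forall x : V, #|[set y | e x y]| = k,
      forall x y : V, e x y -> #|[set z | e x z && e y z]| = la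
    & forall x y : V, x != y -> ~~ e x y -> #|[set z | e x z && e y z]| = mu].

(* The larger root of t^2 - (la - mu) t - (k - mu); for a strongly regular graph
   of diameter 2 it is the second largest adjacency eigenvalue.  For conference
   graphs the discriminant is the number of vertices nu, but not in general. *)
Definition srg_r (R : realType) (k la mu : nat) : R :=
  2^-1 * (la%:R - mu%:R
          + Num.sqrt ((la%:R - mu%:R) ^+ 2 + 4 * (k%:R - mu%:R))).

(* Main.v *)
(* Lower bounds are Poincare inequalities.  Both H(q,n) and J(v,n) contain an
   isometric n-cube, where the sum of the squared antipodal distances is at most
   the sum of the squared edge lengths; scaled indicator vectors attain
   the resulting bound sqrt n.  For a strongly regular graph with eigenvalues
   k > r > s, the projection onto the s-eigenspace is positive semidefinite and
   vanishes on constants, which is an inequality between the squared lengths of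
   edges and nonedges; the projection onto the r-eigenspace gives an embedding
   for which it is an equality. *)
Require Import Defs.
From mathcomp Require Import all_boot all_order all_algebra.
From mathcomp Require Import reals.
From mathcomp Require Import ring lra.

Set Implicit Arguments.
Unset Strict Implicit.

Import Order.TTheory GRing.Theory Num.Theory.
Local Open Scope ring_scope.

(** * Distortion in squared form, and a Poincare inequality for commuting involutions *)

Lemma enorm_ge0 (R : realType) (n : nat) (u : 'rV[R]_n) : 0 <= enorm u.
Proof. exact: sqrtr_ge0. Qed.

Lemma enorm_sqr (R : realType) (n : nat) (u : 'rV[R]_n) :
  enorm u ^+ 2 = \sum_i u 0 i ^+ 2.
Proof. by rewrite sqr_sqrtr // sumr_ge0 // => i _; rewrite sqr_ge0. Qed.

(** Lets an embedding into [R^#|X|] be given by coordinates over any index type no larger than [X]: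
    the surplus coordinates read the default [0] of [nth] and contribute nothing. *)
Lemma finType_coordinates (R : realType) (X J : finType) (h : X -> J -> R) :
  (#|J| <= #|X|)%N ->
  exists rho : X -> 'rV[R]_#|X|,
    forall x y, enorm (rho x - rho y) ^+ 2 = \sum_j (h x j - h y j) ^+ 2.
Proof.
move=> leJX; pose c x := [seq h x j | j <- enum J].
have sc x : size (c x) = #|J| by rewrite size_map -cardE.
exists (fun x => \row_i nth 0 (c x) i) => x y.
rewrite enorm_sqr (bigID (fun i : 'I__ => (i < #|J|)%N)) /= addrC big1 ?add0r.
  pose F i := (nth 0 (c x) i - nth 0 (c y) i) ^+ 2.
  under eq_bigr => i _ do rewrite !mxE -/(F i).
  rewrite -(big_ord_widen _ F leJX) -[RHS]big_enum /=.
  case: (pickP J) => [j0 _|J0]; last first.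
    by rewrite !big1_seq // => [j|[i /= +] _]; [have := J0 j | rewrite eq_card0].
  rewrite [RHS](big_nth j0) -cardE big_mkord; apply: eq_bigr => i _.
  by rewrite /F /c !(nth_map j0) -?enumT -?cardE ?ltn_ord.
move=> i; rewrite -leqNgt => leJi.
by rewrite !mxE !nth_default ?sc // subrr expr0n.
Qed.

(** Both sides of each distance inequality are nonnegative, so they may be squared. Squared
    distances are sums over coordinates, to which one-dimensional Poincare inequalities apply term
    by term. *)
Lemma is_c2_sqr (R : realType) (X J : finType) (d : X -> X -> R) (D : R)
    (h : X -> J -> R) :
  (forall x y, 0 <= d x y) -> 0 <= D -> (#|J| <= #|X|)%N ->
  (forall x y, d x y ^+ 2 <= \sum_j (h x j - h y j) ^+ 2) ->
  (forall x y, \sum_j (h x j - h y j) ^+ 2 <= (D * d x y) ^+ 2) ->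
  (forall (D' : R) (I : finType) (f : X -> I -> R), 0 <= D' ->
     (forall x y, d x y ^+ 2 <= \sum_i (f x i - f y i) ^+ 2) ->
     (forall x y, \sum_i (f x i - f y i) ^+ 2 <= D' ^+ 2 * d x y ^+ 2) ->
     D ^+ 2 <= D' ^+ 2) ->
  is_c2 d D.
Proof.
move=> d0 D0 leJX hlo hhi low; split=> //.
  have [rho rhoE] := @finType_coordinates _ _ _ h leJX.
  exists rho => x y; split.
    by rewrite -ler_sqr ?nnegrE ?enorm_ge0 ?rhoE.
  by rewrite -ler_sqr ?nnegrE ?enorm_ge0 ?mulr_ge0 ?rhoE.
move=> D' rho D'0 Hrho; rewrite -ler_sqr ?nnegrE //.
have E x y : \sum_i (rho x 0 i - rho y 0 i) ^+ 2 = enorm (rho x - rho y) ^+ 2.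
  by rewrite enorm_sqr; apply: eq_bigr => i _; rewrite !mxE.
apply: (low D' 'I_#|X| (fun x i => rho x 0 i)) => // x y; rewrite E.
  by have [H _] := Hrho x y; rewrite ler_sqr ?nnegrE ?enorm_ge0.
have [_ H] := Hrho x y.
by rewrite -exprMn ler_sqr ?nnegrE ?enorm_ge0 ?mulr_ge0.
Qed.

(* Induction on [s]: the quadrilateral inequality for
   [x, t i x, t i (foldr t x s), foldr t x s], summed over [x]. *)
Lemma commuting_involutions_sum_sqr (R : realType) (T : finType) (I : Type)
    (t : I -> T -> T) (f : T -> R) (s : seq I) :
  (forall i, involutive (t i)) ->
  (forall i j x, t i (t j x) = t j (t i x)) ->
  \sum_x (f x - f (foldr t x s)) ^+ 2
    <= \sum_(i <- s) \sum_x (f x - f (t i x)) ^+ 2.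
Proof.
move=> tK tC; elim: s => [|i s IH] /=.
  by rewrite big_nil big1 // => x _; rewrite subrr expr0n.
rewrite big_cons; pose g x := foldr t x s.
have tg x : t i (g x) = g (t i x).
  by rewrite /g; elim: (s) => //= j s' <-; rewrite tC.
have g_inj : injective g.
  rewrite /g; elim: (s) => //= j s' IHs x y /(can_inj (tK j)); exact: IHs.
have R1 (F : T -> R) : \sum_x F x = \sum_x F (t i x).
  by rewrite (reindex_inj (can_inj (tK i))).
apply: le_trans (lerD (lexx _) IH); rewrite -/(foldr t _ _).
(* After summation over [x], the two diagonals of the quadrilateral contribute equally, and so do
   opposite sides; twice the claim is then the summed quadrilateral inequality. *)
have E1 : \sum_x (f (t i x) - f (g x)) ^+ 2 = \sum_x (f x - f (t i (g x))) ^+ 2.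
  by rewrite [RHS]R1; apply: eq_bigr => x _; rewrite tg tK.
have E2 : \sum_x (f (t i (g x)) - f (t i x)) ^+ 2 = \sum_x (f x - f (g x)) ^+ 2.
  by rewrite [RHS]R1; apply: eq_bigr => x _; rewrite tg -opprB sqrrN.
have E3 : \sum_x (f (t i (g x)) - f (g x)) ^+ 2 = \sum_x (f x - f (t i x)) ^+ 2.
  rewrite [RHS](reindex_inj g_inj); apply: eq_bigr => x _.
  by rewrite -opprB sqrrN.
rewrite -(ler_pM2l (_ : 0 < 2 :> R)) ?ltr0n // !mulr_natl !mulr2n.
rewrite -[X in X + _]E1 -[X in _ <= _ + (_ + X)]E2 -[X in _ <= X + _ + _]E3.
rewrite -!big_split ler_sum // => x _ /=.
(* This square is exactly the four squared sides minus the two squared diagonals. *)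
have := sqr_ge0 (f x - f (t i x) - f (g x) + f (t i (g x))).
by lra.
Qed.

(** * Graph distance and embedded cubes *)

(** Following [dstep] builds a walk of length [delta x y]; by [dlip], [delta] drops by at most one
    along an edge, so no walk is shorter. *)
Lemma gdist_eq (V : finType) (e : rel V) (delta : V -> V -> nat) :
  (forall x, delta x x = 0%N) ->
  (forall x y z, e x y -> (delta x z <= (delta y z).+1)%N) ->
  (forall x y, x != y -> exists2 z, e x z & delta x y = (delta z y).+1) ->
  forall x y, gdist e x y = delta x y.
Proof.
move=> d0 dlip dstep x y.
have [p [ep lp sp]] :
    exists p, [/\ path e x p, last x p = y & size p = delta x y].
  move E: (delta x y) => m; elim: m x E => [|m IH] x E.
    by exists [::]; split=> //; apply/eqP/contraT => /dstep[z _]; rewrite E.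
  have [xy|/dstep[z exz]] := eqVneq x y; first by rewrite xy d0 in E.
  rewrite E => -[/esym/IH[p [ep lp sp]]].
  by exists (z :: p); rewrite /= exz sp.
have [|[q [eq lq <-]] min] := @gdistP _ e x y.
  by apply/connectP; exists p.
apply/eqP; rewrite eqn_leq -{1}sp min //= {p ep lp sp min}.
elim: q x lq eq => [x /= -> _|z q IH x /= lq /andP[exz eq]].
  by rewrite d0.
by rewrite (leq_trans (dlip _ _ _ exz)) // ltnS IH.
Qed.

Definition flip (n : nat) (i : 'I_n) (s : {ffun 'I_n -> bool}) :
  {ffun 'I_n -> bool} := [ffun j => s j (+) (j == i)].

Lemma flipK (n : nat) (i : 'I_n) : involutive (flip i).
Proof. by move=> s; apply/ffunP => j; rewrite !ffunE addbK. Qed.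

Lemma flipC (n : nat) (i j : 'I_n) s : flip i (flip j s) = flip j (flip i s).
Proof. by apply/ffunP => l; rewrite !ffunE addbAC. Qed.

(** Exhibits the antipodal map as a composition of commuting involutions, the form that
    [commuting_involutions_sum_sqr] takes. *)
Lemma foldr_flip (n : nat) (s : {ffun 'I_n -> bool}) :
  foldr (@flip n) s (enum 'I_n) = [ffun i => ~~ s i].
Proof.
have H r : uniq r -> foldr (@flip n) s r = [ffun j => s j (+) (j \in r)].
  elim: r => [_|i r IH /= /andP[ir ur]]; apply/ffunP => j; rewrite !ffunE.
    by rewrite /= addbF.
  rewrite IH // ffunE inE; case: eqVneq => [->|_]; last by rewrite addbF.
  by rewrite (negPf ir) addbF.
by rewrite H ?enum_uniq //; apply/ffunP => j; rewrite !ffunE mem_enum addbT.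
Qed.

(** Antipodes have squared image distance at least [n^2] and cube edges at most [D^2], so the
    Poincare inequality gives [2^n * n^2 <= 2^n * n * D^2]. *)
Lemma cube_distortion (R : realType) (V J : finType) (n : nat)
    (d : V -> V -> nat) (g : {ffun 'I_n -> bool} -> V) (f : V -> J -> R) (D : R) :
  (forall s, (n <= d (g s) (g [ffun i => ~~ s i]))%N) ->
  (forall s i, (d (g s) (g (flip i s)) <= 1)%N) ->
  (forall x y, (d x y)%:R ^+ 2 <= \sum_j (f x j - f y j) ^+ 2) ->
  (forall x y, \sum_j (f x j - f y j) ^+ 2 <= D ^+ 2 * (d x y)%:R ^+ 2) ->
  n%:R <= D ^+ 2.
Proof.
move=> dopp dflip flo fhi.
have [->|n0] := posnP n; first by rewrite sqr_ge0.
pose T : finType := {ffun 'I_n -> bool}.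
have c0 : 0 < #|T|%:R :> R by rewrite ltr0n card_ffun card_bool expn_gt0.
have n0' : 0 < n%:R :> R by rewrite ltr0n.
rewrite -(ler_pM2l n0') -(ler_pM2l c0).
pose S := \sum_(s : T) \sum_j (f (g s) j - f (g [ffun i => ~~ s i]) j) ^+ 2.
apply: (@le_trans _ _ S).
  rewrite mulr_natl -sumr_const ler_sum // => s _; apply: le_trans (flo _ _).
  by rewrite -expr2 ler_sqr ?nnegrE ?ler0n // ler_nat.
apply: (@le_trans _ _
    (\sum_(s : T) \sum_(i < n) \sum_j (f (g s) j - f (g (flip i s)) j) ^+ 2)).
  under [X in _ <= X]eq_bigr do rewrite exchange_big.
  rewrite /S exchange_big [X in _ <= X]exchange_big ler_sum //= => j _.
  under eq_bigr do rewrite -foldr_flip.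
  rewrite [X in _ <= X]exchange_big /= -[X in _ <= X]big_enum /=.
  exact: (@commuting_involutions_sum_sqr _ _ _ _ (fun s => f (g s) j) _
    (@flipK n) (@flipC n)).
rewrite [leRHS]mulr_natl -sumr_const ler_sum // => s _.
rewrite [leRHS]mulr_natl -[X in _ *+ X]card_ord -sumr_const ler_sum // => i _.
apply: le_trans (fhi _ _) _; rewrite -[leRHS]mulr1 ler_wpM2l ?sqr_ge0 //.
by rewrite expr_le1 ?ler0n // -[leRHS]/(1%:R) ler_nat.
Qed.

Lemma graph_c2_cube (R : realType) (V J : finType) (e : rel V) (n : nat)
    (h : V -> J -> bool) (g : {ffun 'I_n -> bool} -> V) :
  (#|J| <= #|V|)%N ->
  (forall x y, (gdist e x y <= n)%N) ->
  (forall x y, \sum_j ((h x j)%:R - (h y j)%:R) ^+ 2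
     = 2 * (gdist e x y)%:R :> R) ->
  (forall s, (n <= gdist e (g s) (g [ffun i => ~~ s i]))%N) ->
  (forall s i, (gdist e (g s) (g (flip i s)) <= 1)%N) ->
  is_graph_c2 e (Num.sqrt (n%:R : R)).
Proof.
move=> leJV dn hE dopp dflip.
(* This scaling turns the squared distance [2 d] into [n d], which is at least [d^2] since [d <= n],
   and at most [n d^2] since [d] is a natural number. *)
pose c : R := Num.sqrt (n%:R / 2).
have sn : Num.sqrt (n%:R : R) ^+ 2 = n%:R by rewrite sqr_sqrtr.
have hcE x y : \sum_j (c * (h x j)%:R - c * (h y j)%:R) ^+ 2
    = n%:R * (gdist e x y)%:R.
  under eq_bigr do rewrite -mulrBr exprMn.
  rewrite -mulr_sumr hE sqr_sqrtr ?divr_ge0 //.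
  by rewrite mulrA divfK ?pnatr_eq0.
apply: (@is_c2_sqr _ _ J _ _ (fun x j => c * (h x j)%:R)) => //.
- exact: sqrtr_ge0.
- by move=> x y; rewrite hcE expr2 ler_wpM2r // ler_nat.
- move=> x y; rewrite hcE exprMn sn ler_wpM2l // -natrX ler_nat.
  by case: (gdist e x y) => // m; rewrite leq_pmulr.
- move=> D' I f D0 flo fhi; rewrite sn.
  exact: (@cube_distortion _ _ _ _ (gdist e) g f).
Qed.

(** Dimension count for Hamming graphs: [n * q] indicator coordinates fit among [q ^ n] vertices. *)
Lemma leq_mul_expn (q n : nat) : (1 < q)%N -> (n * q <= q ^ n)%N.
Proof.
move=> q1; case: n => // n; rewrite expnSr leq_mul2r ltn_expl ?orbT //.
Qed.

(** Dimension count for Johnson graphs: [v] indicator coordinates fit among ['C(v, n)] vertices. *)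
Lemma leq_bin (v n : nat) : (0 < n < v)%N -> (v <= 'C(v, n))%N.
Proof.
elim: v n => [|v IH] [|n] //; rewrite ltnS => /= nv.
move: nv; rewrite leq_eqVlt => /predU1P[<-|nv]; first by rewrite binSn.
by rewrite binS -addn1 leq_add ?IH // bin_gt0 ltnW // ltnW.
Qed.

(** * Hamming graphs *)

Section Hamming.

Variables (X : finType) (n : nat).
Implicit Types x y z : n.-tuple X.

Definition hamming_dist x y := #|[set i : 'I_n | tnth x i != tnth y i]|.

Lemma gdist_hamming x y : gdist (hamming X n) x y = hamming_dist x y.
Proof.
move: x y; apply: gdist_eq => [x|x y z|x y].
- by apply/eqP; rewrite cards_eq0; apply/eqP/setP => i; rewrite !inE eqxx.
- move/eqP => dxy; rewrite -add1n -{1}dxy -cardsUI.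
  apply: leq_trans (leq_addr _ _); apply: subset_leq_card.
  apply/subsetP => i; rewrite !inE -negb_and; apply: contraNN.
  by case/andP => /eqP-> /eqP->.
move=> xy; have /existsP[i xyi] : [exists i, tnth x i != tnth y i].
  apply: contra_neqT xy; rewrite negb_exists => /forallP xy.
  by apply: eq_from_tnth => i; apply/eqP; rewrite -[_ == _]negbK xy.
(* Moving one differing coordinate to its value in [y] crosses an edge and lowers the distance by
   one. *)
exists [tuple if j == i then tnth y i else tnth x j | j < n].
  rewrite /hamming -(cards1 i); apply/eqP; congr #|pred_of_set _|.
  apply/setP => j; rewrite !inE tnth_mktuple.
  by case: (eqVneq j i) => [->|_]; rewrite ?eqxx ?xyi.
rewrite /hamming_dist (cardsD1 i) inE xyi add1n; congr (#|pred_of_set _|.+1).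
apply/setP => j; rewrite !inE tnth_mktuple.
by case: (eqVneq j i) => [->|_]; rewrite ?eqxx ?xyi.
Qed.

Lemma c2_hamming (R : realType) :
  (2 <= #|X|)%N -> is_graph_c2 (hamming X n) (Num.sqrt (n%:R : R)).
Proof.
move=> X2; have [a [b [_ _ ab]]] : exists a b : X, [/\ a \in X, b \in X & a != b].
  by apply/card_gt1P.
(* Coordinate [(i, u)] tests whether the [i]-th entry is [u]; each differing position changes two of
   these, which is the factor 2. The cube consists of the words over the two letters [a] and [b]. *)
pose J : finType := ('I_n * X)%type.
apply: (@graph_c2_cube _ _ J _ n (fun x j => tnth x j.1 == j.2)
  (fun s => [tuple if s i then a else b | i < n])).
- by rewrite card_prod card_ord card_tuple leq_mul_expn.
- by move=> x y; rewrite gdist_hamming -[leqRHS]card_ord max_card.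
- move=> x y; rewrite gdist_hamming /hamming_dist -sum1_card natr_sum mulr_sumr.
  rewrite -(pair_bigA _ (fun i u => ((tnth x i == u)%:R - (tnth y i == u)%:R) ^+ 2)).
  rewrite [RHS]big_mkcond; apply: eq_bigr => i _ /=; rewrite inE.
  case: eqVneq => [->|xyi] /=.
    by rewrite big1 // => u _; rewrite subrr expr0n.
  have yxi : tnth y i != tnth x i by rewrite eq_sym.
  rewrite (bigD1 (tnth x i)) //= (bigD1 (tnth y i)) //= big1.
    by rewrite !eqxx (negPf xyi) (negPf yxi) /= subr0 sub0r sqrrN expr1n addr0 mulr1.
  by move=> u /andP[ux uy]; rewrite ![_ == u]eq_sym (negPf ux) (negPf uy) subrr expr0n.
- move=> s; rewrite gdist_hamming -[leqLHS]card_ord subset_leq_card //.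
  apply/subsetP => i _; rewrite inE !tnth_mktuple ffunE.
  by case: (s i); rewrite // eq_sym.
- move=> s i; rewrite gdist_hamming -(cards1 i) subset_leq_card //.
  apply/subsetP => j; rewrite !inE !tnth_mktuple ffunE; apply: contraNT.
  by move/negPf ->; rewrite addbF.
Qed.

End Hamming.

(** * Johnson graphs *)

Section Johnson.

Variables (V : finType) (n : nat).
Implicit Types x y z : nsubset V n.

Lemma card_nsubset x : #|val x| = n.
Proof. exact/eqP/(valP x). Qed.

Lemma johnsonE x y : johnson V n x y = (#|val x :\: val y| == 1%N).
Proof.
rewrite /johnson -[X in _ == X](card_nsubset x) -(cardsID (val y) (val x)).
by rewrite -addn1 eqn_add2l eq_sym.
Qed.

Lemma card_nsubsetDC x y : #|val x :\: val y| = #|val y :\: val x|.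
Proof.
apply/eqP; rewrite -(eqn_add2l #|val x :&: val y|) cardsID setIC cardsID.
by rewrite !card_nsubset.
Qed.

Lemma gdist_johnson x y : gdist (johnson V n) x y = #|val x :\: val y|.
Proof.
move: x y; apply: gdist_eq => [x|x y z|x y].
- by rewrite setDv cards0.
- rewrite johnsonE => /eqP dxy; rewrite -add1n -{1}dxy -cardsUI.
  apply: leq_trans (leq_addr _ _); apply: subset_leq_card.
  apply/subsetP => i; rewrite !inE.
  by case: (i \in val x); case: (i \in val y); rewrite //= !andbF.
move=> xy; have xDy : (0 < #|val x :\: val y|)%N.
  rewrite lt0n; apply: contra_neqN xy => /[dup]; rewrite {1}card_nsubsetDC.
  rewrite !cards_eq0 !setD_eq0 => yx xy.
  by apply/val_inj/eqP; rewrite eqEsubset xy yx.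
have [a] := card_gt0P xDy; rewrite inE => /andP[ay ax].
rewrite card_nsubsetDC in xDy.
have [b] := card_gt0P xDy; rewrite inE => /andP[bx b_y].
(* The step towards [y] exchanges [a], in [x] only, for [b], in [y] only. *)
have zn : #|b |: val x :\ a| == n.
  rewrite cardsU1 !inE (negPf bx) andbF -[X in _ == X](card_nsubset x).
  by rewrite (cardsD1 a (val x)) ax.
exists (Sub (b |: val x :\ a) zn : nsubset V n).
  rewrite johnsonE /= -(cards1 a); apply/eqP; congr #|pred_of_set _|.
  apply/setP => i; rewrite !inE; case: (eqVneq i a) => [->|_] /=.
    by rewrite ax andbT orbF; apply: contraNneq bx => <-.
  by case: (i \in val x); rewrite ?andbF // orbT.
rewrite (cardsD1 a) !inE ax ay add1n; congr (#|pred_of_set _|.+1).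
apply/setP => i; rewrite !inE /=; case: (eqVneq i b) => [->|_] //=.
  by rewrite b_y (negPf bx) !andbF.
by rewrite andbCA.
Qed.

Lemma c2_johnson (R : realType) :
  (2 * n <= #|V|)%N -> is_graph_c2 (johnson V n) (Num.sqrt (n%:R : R)).
Proof.
move=> V2n.
(* Since [2 * n <= #|V|], there are [n] disjoint pairs in [V]; choosing one point from each pair
   gives a cube of [n]-subsets. *)
have le : (#|{: 'I_n * bool}| <= #|V|)%N.
  by rewrite card_prod card_ord card_bool mulnC.
pose p (z : 'I_n * bool) : V := enum_val (widen_ord le (enum_rank z)).
have p_inj : injective p.
  by move=> z w /enum_val_inj /(congr1 val) /= /val_inj /enum_rank_inj.
pose G (s : {ffun 'I_n -> bool}) := [set p (i, s i) | i : 'I_n].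
have Gn s : #|G s| == n.
  by rewrite card_imset ?card_ord // => i j /p_inj[].
pose g s : nsubset V n := Sub (G s) (Gn s).
have gD s t : gdist (johnson V n) (g s) (g t) = #|[set i | s i != t i]|.
  rewrite gdist_johnson -(card_imset _ (_ : injective (fun i => p (i, s i)))).
    congr #|pred_of_set _|; apply/setP => u; rewrite inE.
    apply/andP/imsetP => [[ut /imsetP[i _ uE]]|[i]].
      exists i => //; rewrite inE; apply: contraNneq ut => st.
      by apply/imsetP; exists i; rewrite // uE st.
    rewrite inE => st ->; split; last by apply/imsetP; exists i.
    by apply: contra_neqN st => /imsetP[j _ /p_inj[->]].
  by move=> i j /p_inj[].
have dn x y : (gdist (johnson V n) x y <= n)%N.
  by rewrite gdist_johnson -[leqRHS](card_nsubset x) subset_leq_card ?subsetDl.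
have dopp s : (n <= gdist (johnson V n) (g s) (g [ffun i => ~~ s i]))%N.
  rewrite gD -[leqLHS]card_ord subset_leq_card //.
  by apply/subsetP => i _; rewrite inE ffunE; case: (s i).
have dflip s i : (gdist (johnson V n) (g s) (g (flip i s)) <= 1)%N.
  rewrite gD -(cards1 i) subset_leq_card //.
  apply/subsetP => j; rewrite !inE ffunE; apply: contraNT.
  by move/negPf ->; rewrite addbF.
(* Indicator vectors differ on the symmetric difference, whose two halves have equal size. *)
have hE x y : \sum_i ((i \in val x)%:R - (i \in val y)%:R) ^+ 2
    = 2 * (gdist (johnson V n) x y)%:R :> R.
  rewrite gdist_johnson mulr_natl mulr2n {2}card_nsubsetDC.
  rewrite -!sum1_card !natr_sum ![\sum_(_ in _) _]big_mkcond -big_split.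
  apply: eq_bigr => i _; rewrite !inE.
  by case: (i \in val x); case: (i \in val y) => /=; ring.
(* For [n = 0] there is a single vertex, so [#|V|] coordinates may not fit; the empty index type
   serves there. *)
have [n0|n0] := posnP n; last first.
  apply: (@graph_c2_cube _ _ V _ n (fun x i => i \in val x) g) => //.
  have -> : #|nsubset V n| = 'C(#|V|, n).
    by rewrite card_sig -card_draws; apply: eq_card => A; rewrite !inE.
  rewrite leq_bin // n0.
  by rewrite (leq_trans _ V2n) // mul2n -addnn -[ltnLHS]addn0 ltn_add2l.
apply: (@graph_c2_cube _ _ 'I_0 _ n (fun _ _ => true) g) => //.
  by rewrite card_ord.
move=> x y; have := leq_trans (dn x y) (eq_leq n0); rewrite leqn0 => /eqP->.
by rewrite big_ord0 mulr0.
Qed.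

End Johnson.

(** * Strongly regular graphs of diameter 2 *)

(** Supplies the vertices from which the inequalities between the parameters, and later [1 <= D2],
    are read off. *)
Lemma diameter2_path (V : finType) (e : rel V) :
  connected_graph e -> diameter e = 2%N ->
  exists x y z, [/\ x != y, ~~ e x y, e x z & e z y].
Proof.
move=> conn diam.
have [x [y xy2]] : exists x y, (2 <= gdist e x y)%N.
  have /existsP[x /existsP[y xy]] : [exists x, [exists y, 2 <= gdist e x y]%N].
    apply: contra_eqT diam; rewrite negb_exists => /forallP H.
    rewrite neq_ltn; apply/orP; left; rewrite ltnS; apply/bigmax_leqP => x _.
    apply/bigmax_leqP => y _; have := H x; rewrite negb_exists => /forallP/(_ y).
    by rewrite -ltnNge.
  by exists x, y.
have [[p [ep lp sp]] min] := gdistP (conn x y).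
have xy : x != y.
  apply: contraTneq xy2 => xy; rewrite -ltnNge ltnS.
  exact: leq_trans (min [::] _ xy) _.
have nexy : ~~ e x y.
  by apply: contraTN xy2 => exy; rewrite -ltnNge ltnS (min [:: y]) //= exy.
have p2 : size p = 2%N.
  apply/eqP; rewrite sp eqn_leq xy2 andbT -diam.
  by apply: leq_trans (leq_bigmax x); apply: leq_trans (leq_bigmax y).
move: p p2 ep lp {sp} => [|z [|w []]] //= _ /and3P[exz ezw _] wy.
by exists x, y, z; rewrite -wy in xy nexy *; split.
Qed.

(** With [w] the root of the discriminant, [r] and [s] are half of [la - mu + w] and of
    [la - mu - w]. From [mu <= k], [w] is at least the absolute value of [la - mu]; [la < k] keeps
    [s] nonzero when [mu = k]. *)
Lemma srg_roots (R : realType) (k la mu : nat) :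
  (mu <= k)%N -> (la < k)%N ->
  let r : R := srg_r R k la mu in let s := la%:R - mu%:R - r in
  [/\ r * s = mu%:R - k%:R, 0 <= r & s < 0].
Proof.
rewrite -(ler_nat R) -(ler_nat R la.+1) -natr1 /srg_r.
move: (k%:R : R) (la%:R : R) (mu%:R : R) => K L M MK LK.
set w := Num.sqrt _; have w0 : 0 <= w by exact: sqrtr_ge0.
have w2 : w ^+ 2 = (L - M) ^+ 2 + 4 * (K - M).
  by rewrite sqr_sqrtr // addr_ge0 ?sqr_ge0 // mulr_ge0 // subr_ge0.
split.
- have -> : 2^-1 * (L - M + w) * (L - M - 2^-1 * (L - M + w))
      = 4^-1 * ((L - M) ^+ 2 - w ^+ 2) by field.
  by rewrite w2; field.
- suff : M - L <= w by lra.
  by case: (lerP (M - L) w) => // ?; nra.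
- suff : L - M < w by lra.
  by case: (ltrP (L - M) w) => // ?; nra.
Qed.

Section StronglyRegular.

Variables (R : realType) (V : finType) (e : rel V) (nu k la mu : nat).
Hypotheses (e_sym : symmetric e) (e_irr : irreflexive e).
Hypothesis srg : strongly_regular e nu k la mu.

Definition adj x y : R := (e x y)%:R.
Definition delta x y : R := (x == y :> V)%:R.

Lemma adjC x y : adj x y = adj y x. Proof. by rewrite /adj e_sym. Qed.

Lemma deltaC x y : delta x y = delta y x. Proof. by rewrite /delta eq_sym. Qed.

Lemma sum_deltal (f : V -> R) x : \sum_y delta x y * f y = f x.
Proof.
rewrite (bigD1 x) //= /delta eqxx mul1r big1 ?addr0 // => y.
by rewrite eq_sym => /negPf->; rewrite mul0r.
Qed.

Lemma sum_delta x : \sum_y delta x y = 1.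
Proof. by rewrite -[RHS](sum_deltal (fun=> 1) x); apply: eq_bigr => y _; rewrite mulr1. Qed.

Lemma sum_adj x : \sum_y adj x y = k%:R.
Proof.
have [_ hk _ _] := srg; rewrite -(hk x) -sum1_card natr_sum [RHS]big_mkcond /=.
by apply: eq_bigr => y _; rewrite inE /adj; case: (e x y).
Qed.

(** The matrix identity [A^2 = k I + la A + mu (J - I - A)]: entries of [A^2] count common
    neighbors. *)
Lemma adj_sqr x y :
  \sum_z adj x z * adj z y
  = k%:R * delta x y + la%:R * adj x y + mu%:R * (1 - delta x y - adj x y).
Proof.
have -> : \sum_z adj x z * adj z y = #|[set z | e x z && e y z]|%:R.
  rewrite -sum1_card natr_sum [RHS]big_mkcond /=; apply: eq_bigr => z _.
  by rewrite inE /adj -natrM mulnb (e_sym z y); case: (_ && _).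
have [_ hk hla hmu] := srg; rewrite /delta /adj.
have [<-|xy] := eqVneq x y.
  rewrite e_irr -(hk x) !subrr !mulr0 mulr1 !addr0.
  by congr (_%:R); apply: eq_card => z; rewrite !inE andbb.
case: (boolP (e x y)) => [exy|nexy].
  by rewrite hla //= mulr0 add0r mulr1 subr0 subrr mulr0 addr0.
by rewrite hmu //= !mulr0 !add0r !subr0 mulr1.
Qed.

(** Both sides count walks of length two from a fixed vertex, the right one sorted by endpoint. *)
Lemma srg_count : (0 < nu)%N ->
  k%:R ^+ 2 = k%:R + la%:R * k%:R + mu%:R * (nu%:R - 1 - k%:R) :> R.
Proof.
have [<- _ _ _] := srg; case/card_gt0P => x _.
have E : \sum_y \sum_z adj x z * adj z y = k%:R ^+ 2.
  rewrite exchange_big /=; under eq_bigr do rewrite -mulr_sumr sum_adj.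
  by rewrite -mulr_suml sum_adj.
rewrite -E; under eq_bigr do rewrite adj_sqr.
rewrite !big_split /= -!mulr_sumr !sumrB sum_delta sum_adj sumr_const mulr1.
by congr (_ + _ * (_ - _)).
Qed.

(* [A - t I - ((k - t) / nu) J]: for [t], [t'] the roots of
   [t^2 - (la - mu) t - (k - mu)], this is [t' - t] times the orthogonal
   projection onto the eigenspace of [A] for [t']. *)
Definition eigproj (t : R) x y : R :=
  adj x y - t * delta x y - (k%:R - t) / nu%:R.

Lemma eigprojC t x y : eigproj t x y = eigproj t y x.
Proof. by rewrite /eigproj adjC deltaC. Qed.

Lemma sum_eigproj t x : (0 < nu)%N -> \sum_y eigproj t x y = 0.
Proof.
move=> nu0; rewrite !sumrB -mulr_sumr sum_delta sum_adj sumr_const.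
have [-> _ _ _] := srg; rewrite -[X in _ - X]mulr_natr divfK ?pnatr_eq0 -?lt0n //.
by rewrite mulr1 subrr.
Qed.

Section Roots.

Variables t t' : R.
Hypotheses (nu0 : (0 < nu)%N) (tD : t + t' = la%:R - mu%:R)
  (tM : t * t' = mu%:R - k%:R).

(** The quadratic with roots [t] and [t'], evaluated at [k]. *)
Lemma srg_roots_prod : (k%:R - t) * (k%:R - t') = nu%:R * mu%:R.
Proof.
have -> : (k%:R - t) * (k%:R - t') = k%:R ^+ 2 - k%:R * (t + t') + t * t'.
  by ring.
by rewrite tD tM srg_count //; ring.
Qed.

(** Write [M] for [eigproj t] and [c] for its coefficient of [J]. Then [M J = 0] and [M A = t' M],
    so [M (A - t I - c J) = (t' - t) M]. The relation [cE] makes the [J] terms agree. *)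
Lemma eigproj_sqr x y :
  \sum_z eigproj t x z * eigproj t z y = (t' - t) * eigproj t x y.
Proof.
have nuN0 : nu%:R != 0 :> R by rewrite pnatr_eq0 -lt0n.
set c : R := (k%:R - t) / nu%:R.
have cE : c * (k%:R - t') = mu%:R.
  by rewrite mulrAC srg_roots_prod mulrAC mulfV // mul1r.
have -> : \sum_z eigproj t x z * eigproj t z y
    = \sum_z eigproj t x z * adj z y - t * \sum_z delta y z * eigproj t x z
      - c * \sum_z eigproj t x z.
  rewrite !mulr_sumr -!sumrB; apply: eq_bigr => z _.
  by rewrite {2}/eigproj -/c (deltaC z y); ring.
rewrite sum_deltal sum_eigproj // mulr0 subr0.
have -> : \sum_z eigproj t x z * adj z y
    = \sum_z adj x z * adj z y - t * \sum_z delta x z * adj z y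
      - c * \sum_z adj y z.
  rewrite !mulr_sumr -!sumrB; apply: eq_bigr => z _.
  by rewrite /eigproj -/c (adjC y z); ring.
rewrite adj_sqr sum_deltal sum_adj /eigproj -/c.
have -> : la%:R = t + t' + mu%:R by rewrite tD subrK.
have {1}-> : k%:R = mu%:R - t * t' by rewrite tM opprB addrC subrK.
have -> : c * k%:R = mu%:R + c * t' by rewrite -cE; ring.
ring.
Qed.

(** Rows and columns of [M] sum to zero, so the form is [-2 q] with [q = f^T M f]. By [eigproj_sqr],
    [(t' - t) q] is the squared norm of [M f], hence [q <= 0]. *)
Lemma sum_eigproj_sqrB (f : V -> R) :
  t' < t -> 0 <= \sum_x \sum_y eigproj t x y * (f x - f y) ^+ 2.
Proof.
move=> lt_t; pose q := \sum_x \sum_y eigproj t x y * (f x * f y).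
have qE : \sum_z (\sum_x eigproj t x z * f x) ^+ 2 = (t' - t) * q.
  transitivity (\sum_z \sum_x \sum_y
      (eigproj t x z * eigproj t z y) * (f x * f y)).
    apply: eq_bigr => z _; rewrite expr2 mulr_suml; apply: eq_bigr => x _.
    rewrite mulr_sumr; apply: eq_bigr => y _.
    by rewrite (eigprojC t z y); ring.
  rewrite exchange_big /q mulr_sumr; apply: eq_bigr => x _.
  rewrite exchange_big mulr_sumr; apply: eq_bigr => y _.
  by rewrite -mulr_suml eigproj_sqr -mulrA.
have -> : \sum_x \sum_y eigproj t x y * (f x - f y) ^+ 2 = - 2 * q.
  transitivity (\sum_x (f x ^+ 2 * \sum_y eigproj t x y)
      + \sum_x \sum_y f y ^+ 2 * eigproj t x y - 2 * q).
    rewrite /q mulr_sumr -big_split -sumrB /=; apply: eq_bigr => x _.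
    rewrite !mulr_sumr -big_split -sumrB /=; apply: eq_bigr => y _; ring.
  rewrite exchange_big /= !big1 ?add0r ?addr0 ?sub0r ?mulNr // => x _.
    under eq_bigr do rewrite eigprojC.
    by rewrite -mulr_sumr sum_eigproj ?mulr0.
  by rewrite sum_eigproj ?mulr0.
have : 0 <= (t' - t) * q by rewrite -qE sumr_ge0 // => z _; rewrite sqr_ge0.
by rewrite nmulr_rge0 ?subr_lt0 // => q0; lra.
Qed.

(** The rows of [M] serve as an embedding; their inner products are entries of [M^2], a multiple of
    [M], so all edges get one length and all nonedges another. *)
Lemma sum_sqr_eigprojB x y :
  \sum_z (eigproj t x z - eigproj t y z) ^+ 2
  = 2 * (t' - t) * (- t * (1 - delta x y) - adj x y).
Proof.
transitivity (\sum_z eigproj t x z * eigproj t z x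
    - 2 * \sum_z eigproj t x z * eigproj t z y
    + \sum_z eigproj t y z * eigproj t z y).
  rewrite mulr_sumr -sumrB -big_split; apply: eq_bigr => z _ /=.
  by rewrite (eigprojC t z x) (eigprojC t z y); ring.
by rewrite !eigproj_sqr /eigproj /adj /delta !e_irr !eqxx /=; ring.
Qed.

End Roots.

Lemma gdist_srg x y : (0 < mu)%N ->
  gdist e x y = if x == y then 0%N else if e x y then 1%N else 2.
Proof.
move=> mu0; move: x y; apply: gdist_eq => [x|x y z exy|x y xy].
- by rewrite eqxx.
- case: (eqVneq y z) => [<-|_]; first by rewrite exy; case: ifP.
  by case: eqVneq; case: (e x z); case: (e y z).
rewrite (negPf xy); case: ifP => [exy|/negbT nexy].
  by exists y; rewrite ?eqxx.
have [_ _ _ hmu] := srg; move: mu0; rewrite -(hmu x y) //.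
case/card_gt0P => z; rewrite inE => /andP[exz eyz]; exists z => //.
by rewrite e_sym eyz; case: eqVneq => // zy; rewrite -zy exz in nexy.
Qed.

Lemma srg_bounds (x y z : V) : x != y -> ~~ e x y -> e x z -> e z y ->
  [/\ (0 < mu)%N, (mu <= k)%N, (la < k)%N & (k.+1 < nu)%N].
Proof.
move=> xy nexy exz ezy; have [hnu hk hla hmu] := srg.
split.
- rewrite -(hmu x y) //; apply/card_gt0P; exists z.
  by rewrite inE exz e_sym.
- rewrite -(hmu x y) // -(hk x) subset_leq_card //.
  by apply/subsetP => u; rewrite !inE => /andP[].
- rewrite -(hla x z) // -(hk x) proper_card //; apply/properP; split.
    by apply/subsetP => u; rewrite !inE => /andP[].
  by exists z; rewrite !inE ?e_irr ?andbF.
- rewrite -hnu -(hk x) -[ltnLHS]/(1 + _)%N.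
  have -> : (1 + #|[set z | e x z]|)%N = #|x |: [set z | e x z]|.
    by rewrite cardsU1 inE e_irr.
  rewrite -cardsT proper_card // properT; apply: contraNneq nexy => H.
  by have := in_setT y; rewrite -H !inE eq_sym (negPf xy).
Qed.

Lemma c2_srg : connected_graph e -> diameter e = 2%N ->
  let r : R := srg_r R k la mu in
  is_graph_c2 e
    (Num.sqrt ((4 * (nu%:R - k%:R - 1) * (k%:R - r))
               / (k%:R * (nu%:R - k%:R + r)))).
Proof.
move=> conn diam r; have [x0 [y0 [z0 [xy0 nexy0 exz0 ezy0]]]] :=
  diameter2_path conn diam.
have [mu0 muk lak knu] := srg_bounds xy0 nexy0 exz0 ezy0.
have nu0 : (0 < nu)%N by exact: leq_trans knu.
have [rs r0 s0] := srg_roots R muk lak; rewrite -/r in rs r0 s0.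
set s := _ - r in rs s0.
have rD : r + s = la%:R - mu%:R by rewrite addrC subrK.
have sr : s * r = mu%:R - k%:R by rewrite mulrC.
have sD : s + r = la%:R - mu%:R by rewrite addrC.
have cnt := srg_count nu0; have prod := srg_roots_prod nu0 rD rs.
have k0R : 0 < k%:R :> R by rewrite ltr0n (leq_trans mu0).
have nu0R : 0 < nu%:R :> R by rewrite ltr0n.
have mu0R : 0 < mu%:R :> R by rewrite ltr0n.
have knuR : k%:R + 1 < nu%:R :> R by rewrite natr1 ltr_nat.
have rk : r < k%:R.
  have : 0 < (k%:R - r) * (k%:R - s) by rewrite prod mulr_gt0.
  by rewrite pmulr_lgt0 ?subr_gt0 //; lra.
set D2 := _ / _.
(* The embedding produces the form in [s]. After clearing denominators, [r] and [s] enter only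
   through [r + s] and [r * s], and the difference is a multiple of [srg_count]. *)
have D2E : D2 = 4 * (s + 1) / s.
  have s0' : s != 0 by rewrite lt_eqF.
  have d0 : k%:R * (nu%:R - k%:R + r) != 0 by rewrite mulf_neq0 ?gt_eqF //; lra.
  apply/eqP; rewrite /D2 eqr_div //; apply/eqP.
  apply/eqP; rewrite -subr_eq0; apply/eqP; transitivity
    (- 4 * (k%:R * (r + s + r * s + (nu%:R - k%:R)) + r * s * (nu%:R - k%:R - 1))).
    by ring.
  transitivity (4 * (k%:R ^+ 2
      - (k%:R + la%:R * k%:R + mu%:R * (nu%:R - 1 - k%:R))) : R).
    by rewrite rD rs; ring.
  by rewrite -cnt subrr mulr0.
have D2ge0 : 0 <= D2.
  by rewrite divr_ge0 ?mulr_ge0 //; lra.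
have dE x y : (gdist e x y)%:R = 2 * (1 - delta x y) - adj x y :> R.
  rewrite gdist_srg // /delta /adj; case: eqVneq => [->|_].
    by rewrite e_irr /=; ring.
  by case: (e x y) => /=; ring.
(* Chosen so that nonedges get squared length exactly [4]; edges then get [D2]. *)
pose c : R := Num.sqrt (2 / ((r - s) * - s)).
have hE x y : \sum_j (c * eigproj s x j - c * eigproj s y j) ^+ 2
    = 4 * (1 - delta x y) + (D2 - 4) * adj x y.
  under eq_bigr do rewrite -mulrBr exprMn.
  rewrite -mulr_sumr (sum_sqr_eigprojB nu0 sD sr) sqr_sqrtr; last first.
    by rewrite divr_ge0 ?mulr_ge0 //; lra.
  by rewrite D2E; field; rewrite (lt_eqF s0) gt_eqF //; lra.
(* Edges must not be contracted. A nonedge spanned by two edges gives [4 <= 2 * D2 + 2 * D2]. *)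
have D2ge1 : 1 <= D2.
  have yz0 : y0 != z0 by apply: contraNneq nexy0 => ->.
  have xz0 : x0 != z0 by apply: contraNneq nexy0 => ->.
  have := hE x0 y0; rewrite /delta /adj (negPf xy0) (negPf nexy0) /= => E1.
  have := hE x0 z0; rewrite /delta /adj (negPf xz0) exz0 /= => E2.
  have := hE y0 z0; rewrite /delta /adj (negPf yz0) e_sym ezy0 /= => E3.
  have : \sum_j (c * eigproj s x0 j - c * eigproj s y0 j) ^+ 2
      <= 2 * \sum_j (c * eigproj s x0 j - c * eigproj s z0 j) ^+ 2
         + 2 * \sum_j (c * eigproj s y0 j - c * eigproj s z0 j) ^+ 2.
    rewrite !mulr_sumr -big_split; apply: ler_sum => j _ /=.
    move: (c * _) (c * _) (c * _) => u v w.
    by have := sqr_ge0 (v + w - 2 * u); lra.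
  by rewrite E1 E2 E3; lra.
apply: (@is_c2_sqr _ _ V _ _ (fun x j => c * eigproj s x j)) => //.
- exact: sqrtr_ge0.
- move=> x y; rewrite hE dE /delta /adj; case: eqVneq => [->|_].
    by rewrite e_irr /=; lra.
  by case: (e x y) => /=; lra.
- move=> x y; rewrite hE exprMn sqr_sqrtr // dE /delta /adj.
  case: eqVneq => [->|_]; first by rewrite e_irr /=; lra.
  by case: (e x y) => /=; lra.
move=> D' I f D'0 flo fhi; rewrite sqr_sqrtr //.
have key : 0 <= \sum_x \sum_y eigproj r x y * \sum_i (f x i - f y i) ^+ 2.
  have -> : \sum_x \sum_y eigproj r x y * \sum_i (f x i - f y i) ^+ 2
      = \sum_i \sum_x \sum_y eigproj r x y * (f x i - f y i) ^+ 2.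
    rewrite [RHS]exchange_big; apply: eq_bigr => x _.
    rewrite [RHS]exchange_big; apply: eq_bigr => y _.
    by rewrite mulr_sumr.
  apply: sumr_ge0 => i _; apply: (sum_eigproj_sqrB nu0 rD rs (fun x => f x i)).
  by lra.
(* [eigproj r] has weight [1 - b >= 0] on edges, where squared lengths are at most [D'^2], and
   [- b <= 0] on nonedges, where they are at least [4]. *)
pose b : R := (k%:R - r) / nu%:R.
have bE : b * nu%:R = k%:R - r by rewrite divfK ?gt_eqF.
have b0 : 0 <= b by rewrite divr_ge0 // subr_ge0 ltW.
have b1 : b <= 1 by rewrite ler_pdivrMr //; lra.
have : 0 <= \sum_x \sum_y
    ((1 - b) * D' ^+ 2 * adj x y - 4 * b * (1 - delta x y - adj x y)).
  apply: le_trans key _; apply: ler_sum => x _; apply: ler_sum => y _.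
  have := flo x y; have := fhi x y; rewrite dE /eigproj -/b.
  move: (\sum_i _) => q; rewrite /delta /adj.
  case: eqVneq => [->|_].
    rewrite e_irr /= => H1 H2; have -> : q = 0 by lra.
    by lra.
  case: (e x y) => /= H1 H2; nra.
(* Each vertex has [k] neighbors and [nu - 1 - k] nonneighbors; with [b * nu = k - r], solving for
   [D'^2] gives [D2]. *)
under eq_bigr do rewrite sumrB -!mulr_sumr !sumrB sum_delta sum_adj sumr_const.
rewrite sumr_const; have [-> _ _ _] := srg.
rewrite pmulrn_lge0 // => H; rewrite ler_pdivrMr ?mulr_gt0 //; last by lra.
have := mulr_ge0 (ltW nu0R) H.
have -> : nu%:R * ((1 - b) * D' ^+ 2 * k%:R - 4 * b * (nu%:R - 1 - k%:R))
    = (nu%:R - b * nu%:R) * D' ^+ 2 * k%:R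
      - 4 * (b * nu%:R) * (nu%:R - 1 - k%:R) by ring.
by rewrite bE; lra.
Qed.

End StronglyRegular.

Theorem theorem2p5 (R : realType) :
  (forall (X : finType) (q n : nat),
     #|X| = q -> (2 <= q)%N ->
     is_graph_c2 (hamming X n) (Num.sqrt (n%:R : R)))
  /\
  (forall (V : finType) (v n : nat),
     #|V| = v -> (2 * n <= v)%N ->
     is_graph_c2 (johnson V n) (Num.sqrt (n%:R : R)))
  /\
  (forall (V : finType) (e : rel V) (nu k la mu : nat),
     simple_graph e -> connected_graph e ->
     strongly_regular e nu k la mu -> diameter e = 2%N ->
     let r : R := srg_r R k la mu in
     is_graph_c2 e
       (Num.sqrt ((4 * (nu%:R - k%:R - 1) * (k%:R - r))
                  / (k%:R * (nu%:R - k%:R + r))))).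
Proof.
split; [|split].
- by move=> X q n <-; exact: c2_hamming.
- by move=> V v n <-; exact: c2_johnson.
- by move=> V e nu k la mu [e_sym e_irr] conn srg; exact: c2_srg.
Qed.
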